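(* For every integer $k > 0$ there is a constant $\varepsilon_k > 0$ such that every sufficiently large (in terms of $k$) finite point set $P$ in the plane $\mathbb{R}^2$ in general position contains $2k$ pairwise disjoint subsets $A_1,\ldots,A_k,B_1,\ldots,B_k \subset P$, each of size at least $\varepsilon_k |P|$, such that every pair of sets $A=\{a_1,\ldots,a_k\}$ and $B=\{b_1,\ldots,b_k\}$ with $a_i\in A_i$ and $b_i\in B_i$ for all $1\le i\le k$ is mutually avoiding. Moreover, $\varepsilon_k = \Omega(1/k^4)$, i.e. there is an absolute constant $c>0$ such that one can take $\varepsilon_k \ge c/k^4$ for every $k$.
   Context: A finite point set in the plane is in general position if no three of its members are collinear. For two disjoint point sets $A$ and $B$ in the plane, $A$ avoids $B$ if no line through a pair of (distinct) points of $A$ intersects the convex hull of $B$. The sets $A$ and $B$ are mutually avoiding if $A$ avoids $B$ and $B$ avoids $A$. *)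

(* Defs.v *)
From mathcomp Require Import all_boot all_order all_algebra finmap.
From mathcomp Require Import all_classical reals.
From mathcomp Require Import convex.

Set Implicit Arguments.
Unset Strict Implicit.
Unset Printing Implicit Defensive.

Import Order.TTheory GRing.Theory Num.Theory.

Local Open Scope classical_set_scope.
Local Open Scope ring_scope.

(* This is a line only when p != q; every use below assumes that. *)
Definition line (R : realType) (p q : 'rV[R]_2) : set 'rV[R]_2 :=
  [set p + t *: (q - p) | t in [set: R]].

Definition collinear (R : realType) (x y z : 'rV[R]_2) : Prop :=
  exists p q : 'rV[R]_2, [/\ p != q, line p q x, line p q y & line p q z].

Definition general_position (R : realType) (P : {fset 'rV[R]_2}) : Prop :=
  forall x y z, x \in P -> y \in P -> z \in P ->
    x != y -> x != z -> y != z -> ~ collinear x y z.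

Definition convex_hull (R : realType) (A : set 'rV[R]_2) : set 'rV[R]_2 :=
  smallest (@convex_set R 'rV[R]_2) A.

(* [avoids] and [mutually_avoiding] are meant for disjoint sets; disjointness
   is not part of the definitions. *)
Definition avoids (R : realType) (A B : set 'rV[R]_2) : Prop :=
  forall p q, A p -> A q -> p != q -> line p q `&` convex_hull B = set0.

Definition mutually_avoiding (R : realType) (A B : set 'rV[R]_2) : Prop :=
  avoids A B /\ avoids B A.

(* Main.v *)
(** In coordinates [X, Y] with [X] injective, the orientation of a pair [u, v] at [q],
    where [X u < X v], is that of the triple [q, u, v].  A line [x y] with [X x < X y]
    misses the convex hull of every set lying to the right of [x] on the side of the
    line [q x] not containing [y].  Hence, if [A] precedes [B] and all pairs in
    [A * B] have orientation [e] at [q], then [A] and [B] are mutually avoiding as soon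
    as all pairs in [A] and all pairs in [B] have orientation [~~ e] at [q].

    Cutting the point set into a bounded but large number of vertical chunks, making
    all triples of chunks homogeneous by ham-sandwich cuts, and applying a Ramsey
    argument yields chunks [A, A', Q, B, B'], from left to right, whose transversals
    are all cups (or all caps).  Fix [q] in [Q].  The pairs [A, A'] and [B, B'] then
    have one orientation [e] at [q], and the four pairs across [q] the other one.

    A positive-fraction Erdos-Szekeres theorem for the abscissa and the slope to [q]
    cuts each of the four chunks into [k] parts, each containing a fraction of order
    [1 / k ^ 4], whose transversals all have one orientation at [q].  If [A] and [A'],
    or [B] and [B'], both got [~~ e], parts of the former and of the latter are mutually
    avoiding; otherwise one of [A, A'] and one of [B, B'] got [e], and these two
    are mutually avoiding. *)

Require Import Defs.
From mathcomp Require Import all_boot all_order all_algebra finmap.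
From mathcomp Require Import all_classical reals.
From mathcomp Require Import interval_inference convex.
From mathcomp Require Import ring lra zify.
Import fintype boot.finset.
Set Implicit Arguments.
Unset Strict Implicit.
Unset Printing Implicit Defensive.
Import Order.TTheory GRing.Theory Num.Theory.

Local Open Scope ring_scope.

(** * Order statistics and division into vertical chunks *)

(** Take the least value with more than [j] elements at or below it: if more than [j] elements were
    strictly below, the largest of these would qualify too. The two counts allow for ties. *)
Lemma order_statistic (R : realFieldType) (T : finType) (f : T -> R)
    (S : {set T}) (j : nat) :
  (j < #|S|)%N ->
  exists2 x, x \in S &
    (#|[set y in S | (f y < f x)%R]| <= j < #|[set y in S | (f y <= f x)%R]|)%N.
Proof.
move=> jS; have /card_gt0P[x0 x0S] : (0 < #|S|)%N by apply: leq_ltn_trans jS.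
have [x1 x1S x1max] : exists2 x, x \in S & {in S, forall y, f y <= f x}.
  by case: (@arg_maxP _ _ _ x0 (mem S) f x0S) => x xS xm; exists x.
pose P x := (x \in S) && (j < #|[set y in S | (f y <= f x)%R]|)%N.
have Px1 : P x1.
  rewrite /P x1S (leq_trans jS)//; apply/subset_leq_card/subsetP => y yS.
  by rewrite inE yS x1max.
case: (@arg_minP _ _ _ x1 P f Px1) => x /andP[xS jx] xmin; exists x => //.
rewrite jx andbT leqNgt; apply/negP => jlt.
have /card_gt0P[y0 y0S] : (0 < #|[set y in S | (f y < f x)%R]|)%N.
  by apply: leq_ltn_trans jlt.
case: (@arg_maxP _ _ _ y0 (fun z => z \in [set y in S | f y < f x]) f y0S) => y /=.
rewrite !inE => /andP[yS yx] ymax.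
have /xmin : P y.
  rewrite /P yS (leq_trans jlt)//; apply/subset_leq_card/subsetP => z zS.
  by move: (zS); rewrite !inE => /andP[-> _]; apply: ymax.
by rewrite leNgt yx.
Qed.

(** Induction from the right: the order statistic of index [(M - 1) * w] cuts off the last chunk,
    which absorbs any surplus, and leaves exactly enough for the others. *)
Lemma ordered_chunks (R : realFieldType) (T : finType) (f : T -> R)
    (w M : nat) (S : {set T}) :
  {in S &, injective f} -> (M * w <= #|S|)%N ->
  exists C : nat -> {set T},
    [/\ forall i, (i < M)%N -> C i \subset S,
        forall i, (i < M)%N -> (w <= #|C i|)%N &
        forall i j x y, (i < j)%N -> (j < M)%N -> x \in C i -> y \in C j ->
          f x < f y].
Proof.
elim: M S => [|M IH] S injf.
  by exists (fun=> set0); split.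
case: w IH => [|w] IH.
  by exists (fun=> set0); split=> [i _|i _|i j x y _ _]; rewrite ?sub0set ?inE.
rewrite mulSn => MS.
have [|x xS /andP[lt_x le_x]] := order_statistic f (j := (M * w.+1)%N) (S := S).
  by lia.
set L := [set y in S | f y < f x] in lt_x.
have LS : L \subset S by apply/subsetP => y; rewrite inE => /andP[].
have leE : [set y in S | f y <= f x] = x |: L.
  apply/setP => y; rewrite !inE; case: eqVneq => [->|neq]; first by rewrite xS lexx.
  case yS: (y \in S) => //=; rewrite le_eqVlt; case: eqVneq => //= e.
  by case/eqP: neq; apply: injf.
have cL : #|L| = (M * w.+1)%N.
  apply/eqP; rewrite eqn_leq lt_x /=; move: le_x; rewrite leE cardsU1.
  by rewrite !inE ltxx andbF.
have [|//|C [CL Cw Clt]] := IH L; first by move=> y z /(subsetP LS)+ /(subsetP LS); apply: injf.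
  by rewrite cL.
exists (fun i => if (i < M)%N then C i else S :\: L); split=> [i iM|i iM|i j y z ij jM].
- by case: ifP => [/CL CiL|_]; [apply: subset_trans LS | apply: subsetDl].
- case: ifP => [/Cw //|_].
  by rewrite cardsD (setIidPr LS) cL; lia.
- have iM : (i < M)%N by lia.
  rewrite iM; case: ifP => jM'; first exact: Clt.
  move=> /(subsetP (CL _ iM)); rewrite !inE => /andP[_ yx] /andP[+ zS].
  by rewrite zS /= -leNgt; apply: lt_le_trans.
Qed.

(** * Orientations, ham-sandwich cuts and homogeneous triples *)

(** Twice the signed area of the triangle [a b c] in the [(X, Y)]-plane: positive for a left
    turn. *)
Definition orientation (R : pzRingType) (T : Type) (X Y : T -> R) (a b c : T) : R :=
  (X b - X a) * (Y c - Y a) - (X c - X a) * (Y b - Y a).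

Definition slope (R : fieldType) (T : Type) (X Y : T -> R) (a b : T) : R :=
  (Y b - Y a) / (X b - X a).

Definition generic (R : pzRingType) (T : eqType) (X Y : T -> R) : Prop :=
  injective X /\
  forall a b c, a != b -> a != c -> b != c -> orientation X Y a b c != 0.

Definition same_type (R : numDomainType) (T : finType) (X Y : T -> R)
    (A B C : {set T}) : Prop :=
  exists e : bool, forall a b c, a \in A -> b \in B -> c \in C ->
    0 < (-1) ^+ e * orientation X Y a b c.

Lemma card_halves (R : realFieldType) (T : finType) (f : T -> R) (c : R) (S : {set T}) :
  (#|S| <= 2 * #|[set x in S | (f x <= c)%R]|)%N \/
  (#|S| <= 2 * #|[set x in S | (c <= f x)%R]|)%N.
Proof.
have : (#|S| <= #|[set x in S | (f x <= c)%R]| + #|[set x in S | (c <= f x)%R]|)%N.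
  apply: leq_trans (leq_card_setU _ _); apply/subset_leq_card/subsetP => x xS.
  by rewrite !inE xS /=; exact: le_total.
lia.
Qed.

Lemma card_setIdC (R : realFieldType) (T : finType) (f : T -> R) (c : R) (S : {set T}) :
  (#|[set x in S | (f x < c)%R]| + #|[set x in S | (c <= f x)%R]| = #|S|)%N.
Proof.
rewrite -[RHS](cardsID [set x | f x < c]) setIdE; congr (_ + _)%N.
by apply: eq_card => x; rewrite !inE -leNgt andbC.
Qed.

(* The slope [s] is the median over [a] of the median over [c] of the slopes of [a c];
   the line passes through the point of [A] realising it. *)
Lemma ham_sandwich (R : realFieldType) (T : finType) (X Y : T -> R) (A C : {set T}) :
  (0 < #|A|)%N -> (0 < #|C|)%N ->
  {in A & C, forall a c, X a < X c} ->
  exists s t : R, let v x : R := Y x - s * X x in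
  [/\ (#|A| <= 2 * #|[set x in A | (v x <= t)%R]|)%N,
      (#|A| <= 2 * #|[set x in A | (t <= v x)%R]|)%N,
      (#|C| <= 2 * #|[set x in C | (v x <= t)%R]|)%N &
      (#|C| <= 2 * #|[set x in C | (t <= v x)%R]|)%N].
Proof.
move=> A0 C0 AC.
pose u a c : R := slope X Y a c.
have half (n : nat) : (0 < n -> n./2 < n)%N by lia.
have /fin_all_exists[m mP] (a : T) : exists z, z \in C /\
    (#|[set y in C | (u a y < u a z)%R]| <= #|C|./2
      < #|[set y in C | (u a y <= u a z)%R]|)%N.
  have [z zC hz] := order_statistic (u a) (half _ C0).
  by exists z.
pose sl a : R := u a (m a).
have [p pA hp] := order_statistic sl (half _ A0).
exists (sl p), (Y p - sl p * X p) => v; rewrite -/(v p).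
have slE a c (s : R) : a \in A -> c \in C ->
    ((u a c <= s) = (Y c - s * X c <= Y a - s * X a)) *
    ((s <= u a c) = (Y a - s * X a <= Y c - s * X c)).
  move=> aA cC; have d : 0 < X c - X a by rewrite subr_gt0 AC.
  rewrite /u /slope ler_pdivrMr// ler_pdivlMr//.
  by split; apply/idP/idP => h; lra.
have cnt a : a \in A ->
    (#|C|./2 < #|[set c in C | (Y c - sl a * X c <= Y a - sl a * X a)%R]|)%N /\
    (#|C| <= #|[set c in C | (Y a - sl a * X a <= Y c - sl a * X c)%R]| + #|C|./2)%N.
  move=> aA; have [_ /andP[h1 h2]] := mP a; split.
    rewrite (leq_trans h2)//; apply/subset_leq_card/subsetP => c.
    by rewrite !inE => /andP[cC]; rewrite cC (slE a c _ aA cC).1.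
  rewrite -{1}(card_setIdC (u a) (sl a) C) addnC leq_add//.
  apply/subset_leq_card/subsetP => c.
  by rewrite !inE => /andP[cC]; rewrite cC (slE a c _ aA cC).2.
have meet (S S' : {set T}) : S \subset C -> S' \subset C ->
    (#|C| < #|S| + #|S'|)%N -> exists2 c, c \in S & c \in S'.
  move=> SC S'C h; have /card_gt0P[c] : (0 < #|S :&: S'|)%N.
    have := cardsUI S S'; have : (#|S :|: S'| <= #|C|)%N.
      by apply: subset_leq_card; rewrite subUset SC.
    lia.
  by rewrite inE => /andP[]; exists c.
have subC (P : pred T) : [set c in C | P c] \subset C.
  by apply/subsetP => c; rewrite inE => /andP[].
have [cp1 cp2] : (#|C|./2 < #|[set c in C | (v c <= v p)%R]|)%N /\
    (#|C| <= #|[set c in C | (v p <= v c)%R]| + #|C|./2)%N := cnt p pA.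
(* More than half of [C] lies on or below the line through [p], and at least half on or above the
   line of slope [sl a] through [a]. A common point [c] turns the comparison of slopes into one of
   [v]: the slope of [a c] is at least [sl p]. *)
have low : [set a in A | (sl p <= sl a)%R] \subset [set a in A | (v a <= v p)%R].
  apply/subsetP => a; rewrite !inE => /andP[aA ha]; rewrite aA /=.
  have [_ ca2] := cnt a aA.
  have [||/=|c] := meet [set c in C | (v c <= v p)%R]
     [set c in C | (Y a - sl a * X a <= Y c - sl a * X c)%R]; try exact: subC.
    by move: cp1 ca2; lia.
  rewrite !inE => /andP[cC c1] /andP[_ c2].
  apply: le_trans c1; rewrite /v -(slE a c _ aA cC).2 (le_trans ha)//.
  by rewrite (slE a c _ aA cC).2.
have high : [set a in A | (sl a <= sl p)%R] \subset [set a in A | (v p <= v a)%R].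
  apply/subsetP => a; rewrite !inE => /andP[aA ha]; rewrite aA /=.
  have [ca1 _] := cnt a aA.
  have [||/=|c] := meet [set c in C | (v p <= v c)%R]
     [set c in C | (Y c - sl a * X c <= Y a - sl a * X a)%R]; try exact: subC.
    by move: cp2 ca1; lia.
  rewrite !inE => /andP[cC c1] /andP[_ c2].
  apply: le_trans c1 _; rewrite /v -(slE a c _ aA cC).1 (le_trans _ ha)//.
  by rewrite (slE a c _ aA cC).1.
move/subset_leq_card in low; move/subset_leq_card in high.
have := card_setIdC sl (sl p) A; case/andP: hp => hp1 hp2 e.
by split; lia.
Qed.

(** Keep the half of [B] on one side of a line bisecting [A] and [C], and the halves of [A] and [C]
    on the other side. Then all triples turn the same way; points on the line are harmless because
    no orientation vanishes. *)
Lemma same_type_halves (R : realFieldType) (T : finType) (X Y : T -> R)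
    (A B C : {set T}) :
  generic X Y ->
  (0 < #|A|)%N -> (0 < #|C|)%N ->
  {in A & B, forall a b, X a < X b} -> {in B & C, forall b c, X b < X c} ->
  {in A & C, forall a c, X a < X c} ->
  exists A' B' C' : {set T},
    [/\ [/\ A' \subset A, B' \subset B & C' \subset C],
        [/\ (#|A| <= 2 * #|A'|)%N, (#|B| <= 2 * #|B'|)%N & (#|C| <= 2 * #|C'|)%N] &
        same_type X Y A' B' C'].
Proof.
move=> [_ gen] A0 C0 AB BC AC.
have [s [t]] := ham_sandwich Y A0 C0 AC; set v := fun x => _ => -[Al Ah Cl Ch].
have subS (S : {set T}) (P : pred T) : [set x in S | P x] \subset S.
  by apply/subsetP => c; rewrite inE => /andP[].
have nz a b c : a \in A -> b \in B -> c \in C -> orientation X Y a b c != 0.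
  move=> /[dup] aA /AB ab /[dup] bB /BC bc /[dup] cC /(AC _ _ aA) ac.
  have neq x y : X x < X y -> x != y by apply: contraTneq => ->; rewrite ltxx.
  by apply: gen; apply: neq => //; [exact: ab|exact: bc].
(* Orientation is unchanged when [Y] is replaced by [v], the height relative to the bisecting
   direction. *)
have oriE a b c : orientation X Y a b c =
    (X c - X b) * (v a - v b) + (X b - X a) * (v c - v b).
  by rewrite /orientation /v; ring.
case: (card_halves v t B) => Bh; [exists [set x in A | t <= v x],
   [set x in B | v x <= t], [set x in C | t <= v x] |
   exists [set x in A | v x <= t], [set x in B | t <= v x], [set x in C | v x <= t]].
  split=> //; exists false => a b c; rewrite !inE => /andP[aA av] /andP[bB bv] /andP[cC cv].
  rewrite mul1r lt_def nz//= oriE addr_ge0// mulr_ge0// subr_ge0.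
  - exact/ltW/BC. - exact: le_trans av. - exact/ltW/AB. - exact: le_trans cv.
split=> //; exists true => a b c; rewrite !inE => /andP[aA av] /andP[bB bv] /andP[cC cv].
have -> : (-1) ^+ true * orientation X Y a b c = - orientation X Y a b c by rewrite mulN1r.
have oriNE : - orientation X Y a b c = (X c - X b) * (v b - v a) + (X b - X a) * (v b - v c).
  by rewrite oriE; ring.
rewrite lt_def oppr_eq0 nz//= oriNE addr_ge0// mulr_ge0// subr_ge0.
- exact/ltW/BC. - exact: le_trans bv. - exact/ltW/AB. - exact: le_trans bv.
Qed.

Lemma same_typeS (R : numDomainType) (T : finType) (X Y : T -> R)
    (A B C A' B' C' : {set T}) :
  A' \subset A -> B' \subset B -> C' \subset C ->
  same_type X Y A B C -> same_type X Y A' B' C'.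
Proof.
move=> /subsetP sA /subsetP sB /subsetP sC [e eP]; exists e => a b c aA bB cC.
by apply: eP; [exact: sA|exact: sB|exact: sC].
Qed.

(** Each triple of the list costs a factor of two; homogeneity already obtained survives, since it
    passes to subsets. *)
Lemma same_type_refinement (R : realFieldType) (T : finType) (X Y : T -> R)
    (M : nat) (C : 'I_M -> {set T}) (s : seq ('I_M * 'I_M * 'I_M)) :
  generic X Y -> (forall i, 0 < #|C i|)%N ->
  (forall i j : 'I_M, (i < j)%N -> {in C i & C j, forall x y, X x < X y}) ->
  {in s, forall t : 'I_M * 'I_M * 'I_M, (t.1.1 < t.1.2 < t.2)%N} ->
  exists C' : 'I_M -> {set T},
    [/\ forall i, C' i \subset C i,
        forall i, (#|C i| <= 2 ^ size s * #|C' i|)%N &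
        {in s, forall t : 'I_M * 'I_M * 'I_M, same_type X Y (C' t.1.1) (C' t.1.2) (C' t.2)}].
Proof.
move=> gen C0 Clt; elim: s => [_|[[i j] k] s IH ijks].
  by exists C; split=> // i; rewrite mul1n.
have /andP[/= ij jk] := ijks _ (mem_head _ _).
have [t ts|D [DC Dsz Dst]] := IH; first by apply: ijks; rewrite inE ts orbT.
have D0 l : (0 < #|D l|)%N.
  by have := Dsz l; have := C0 l; case: #|D l| => //; rewrite muln0; lia.
have Dlt (l m : 'I_M) : (l < m)%N -> {in D l & D m, forall x y, X x < X y}.
  by move=> lm x y /(subsetP (DC l)) + /(subsetP (DC m)); apply: Clt.
have [A' [B' [E' [[sA sB sE] [cA cB cE] st]]]] :=
  same_type_halves gen (D0 i) (D0 k) (Dlt _ _ ij) (Dlt _ _ jk) (Dlt _ _ (ltn_trans ij jk)).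
pose C' l := if l == i then A' else if l == j then B' else if l == k then E' else D l.
have ji : (j == i) = false by apply/eqP => e; move: ij; rewrite e ltnn.
have ki : (k == i) = false by apply/eqP => e; move: (ltn_trans ij jk); rewrite e ltnn.
have kj : (k == j) = false by apply/eqP => e; move: jk; rewrite e ltnn.
have C'D l : C' l \subset D l.
  by rewrite /C'; case: eqP => [->//|_]; case: eqP => [->//|_]; case: eqP => [->//|_].
exists C'; split=> [l|l|t].
- exact: subset_trans (C'D l) (DC l).
- rewrite (leq_trans (Dsz l))//= expnS -mulnA mulnCA leq_mul2l; apply/orP; right.
  rewrite /C'; case: eqP => [->//|_]; case: eqP => [->//|_]; case: eqP => [->//|_].
  by rewrite leq_pmull.
- rewrite inE => /orP[/eqP ->/=|ts]; last by apply: same_typeS (Dst t ts).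
  by rewrite /C' eqxx ji eqxx ki kj eqxx.
Qed.

(** * Ramsey argument and chunks in convex position *)

(* Colour each pair i < j by the lengths, up to two, of the longest monochromatic
   monotone paths of triples ending with it.  If no path has three triples, the
   colour of (j, k) is not that of any (i, j), so distinct vertices have distinct
   sets of colours of incoming pairs. *)
Lemma monochromatic_path (M : nat) (col : 'I_M -> 'I_M -> 'I_M -> bool) :
  (#|{set (bool * bool) * (bool * bool)}| < M)%N ->
  exists c (i1 i2 i3 i4 i5 : 'I_M),
    [/\ [/\ (i1 < i2)%N, (i2 < i3)%N, (i3 < i4)%N & (i4 < i5)%N],
        col i1 i2 i3 = c, col i2 i3 i4 = c & col i3 i4 i5 = c].
Proof.
move=> Mbig.
pose L c (i j : 'I_M) := ([exists h : 'I_M, (h < i)%N && (col h i j == c)],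
  [exists g : 'I_M, exists h : 'I_M,
     [&& (g < h)%N, (h < i)%N, col g h i == c & col h i j == c]]).
pose lab i j := (L true i j, L false i j).
have labL i j i' j' c : lab i j = lab i' j' -> L c i j = L c i' j'.
  by case; case: c => // *; congr pair.
pose D (j : 'I_M) := [set l | [exists i : 'I_M, (i < j)%N && (lab i j == l)]].
have : ~~ injectiveb D.
  apply/negP => /injectiveP/leq_card; rewrite card_ord.
  by rewrite leqNgt Mbig.
case/injectivePn => j0 [k0]; wlog : j0 k0 / (j0 < k0)%N => [hw|].
  case: (ltngtP j0 k0) => [lt||/val_inj ->]; [exact: hw| |by rewrite eqxx].
  by move=> lt neq e; apply: (hw k0 j0) => //; rewrite eq_sym.
move=> jk _ eD; have : lab j0 k0 \in D j0.
  by rewrite eD inE; apply/existsP; exists j0; rewrite jk eqxx.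
rewrite inE => /existsP[i /andP[ij /eqP/(labL _ _ _ _ (col i j0 k0)) eL]].
set c := col i j0 k0 in eL.
(* The triple [i, j0, k0] ends a path at [(j0, k0)]. Equal labels give a path of the same length at
   [(i, j0)], which this triple prolongs; two rounds produce three triples. *)
have : (L c j0 k0).1 by apply/existsP; exists i; rewrite ij eqxx.
rewrite -eL => /existsP[h /andP[hi /eqP hc]].
have : (L c j0 k0).2.
  by apply/existsP; exists h; apply/existsP; exists i; rewrite hi ij hc !eqxx.
rewrite -eL => /existsP[g /existsP[h' /and4P[gh h'i /eqP c1 /eqP c2]]].
by exists c, g, h', i, j0, k0.
Qed.

Definition precedes (R : numDomainType) (T : finType) (X Y : T -> R) (q : T) (e : bool)
    (U V : {set T}) : Prop :=
  forall u v, u \in U -> v \in V -> X u < X v /\ 0 < (-1) ^+ e * orientation X Y q u v.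

Lemma orientation_left (R : realFieldType) (T : Type) (X Y : T -> R) (s : R) (a b q c : T) :
  X a < X b -> X b < X q -> X q < X c ->
  0 < s * orientation X Y a b q -> 0 < s * orientation X Y b q c ->
  0 < s * orientation X Y a q c.
Proof.
move=> ab bq qc h1 h2; have : 0 < (X q - X b) * (s * orientation X Y a q c).
  have -> : (X q - X b) * (s * orientation X Y a q c) =
    (X q - X a) * (s * orientation X Y b q c) + (X c - X q) * (s * orientation X Y a b q).
    by rewrite /orientation; ring.
  by rewrite addr_gt0// mulr_gt0// subr_gt0// (lt_trans ab).
by rewrite pmulr_rgt0// subr_gt0.
Qed.

Lemma orientation_right (R : realFieldType) (T : Type) (X Y : T -> R) (s : R) (b q c d : T) :
  X b < X q -> X q < X c -> X c < X d ->
  0 < s * orientation X Y b q c -> 0 < s * orientation X Y q c d ->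
  0 < s * orientation X Y b q d.
Proof.
move=> bq qc cd h1 h2; have : 0 < (X c - X q) * (s * orientation X Y b q d).
  have -> : (X c - X q) * (s * orientation X Y b q d) =
    (X d - X q) * (s * orientation X Y b q c) + (X q - X b) * (s * orientation X Y q c d).
    by rewrite /orientation; ring.
  by rewrite addr_gt0// mulr_gt0// subr_gt0// (lt_trans qc).
by rewrite pmulr_rgt0// subr_gt0.
Qed.

Lemma convex_configuration (R : realFieldType) :
  exists2 c : nat, (0 < c)%N & forall (T : finType) (X Y : T -> R),
  generic X Y -> (c <= #|T|)%N ->
  exists q e (A A' B B' : {set T}),
    [/\ [/\ (#|T| <= c * #|A|)%N, (#|T| <= c * #|A'|)%N,
            (#|T| <= c * #|B|)%N & (#|T| <= c * #|B'|)%N],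
        {in A :|: A', forall a, X a < X q}, {in B :|: B', forall b, X q < X b},
        precedes X Y q e A A' /\ precedes X Y q e B B' &
        precedes X Y q (~~ e) (A :|: A') (B :|: B')].
Proof.
have [M Mbig] : exists M, (#|{set (bool * bool) * (bool * bool)}| < M)%N.
  by exists #|{set (bool * bool) * (bool * bool)}|.+1.
pose s := [seq t : 'I_M * 'I_M * 'I_M <- enum {: 'I_M * 'I_M * 'I_M} | (t.1.1 < t.1.2 < t.2)%N].
have M0 : (0 < M)%N by exact: leq_ltn_trans Mbig.
(* The [2] absorbs the rounding in [#|T| %/ M], and [2 ^ size s] the halvings over all triples of
   chunks. *)
exists (2 * M * 2 ^ size s)%N => [|T X Y gen cT].
  by rewrite !muln_gt0 M0 expn_gt0.
pose w := (#|T| %/ M)%N.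
have w0 : (0 < w)%N.
  by rewrite divn_gt0// (leq_trans _ cT)// -mulnA mulnCA leq_pmulr// muln_gt0 expn_gt0.
have [||C [_ Cw Clt]] := ordered_chunks (f := X) (w := w) (M := M) (S := [set: T]).
- by move=> x y _ _; apply: gen.1.
- by rewrite cardsT mulnC leq_divM.
have [|||D [DC Dsz Dst]] := same_type_refinement (C := fun i : 'I_M => C i) (s := s) gen.
- by move=> i; apply: leq_trans (Cw i _).
- by move=> i j ij x y; apply: Clt.
- by move=> t; rewrite mem_filter => /andP[].
have Dbig i : (#|T| <= 2 * M * 2 ^ size s * #|D i|)%N.
  have h1 : (#|T| < w.+1 * M)%N by rewrite ltn_ceil.
  have h2 : (w <= #|C i|)%N by apply: Cw.
  have wD : (w <= 2 ^ size s * #|D i|)%N by apply: leq_trans (Dsz i).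
  rewrite -(mulnA (2 * M)%N) (leq_trans (ltnW h1))//.
  by rewrite mulnC -mulnA mulnCA leq_mul2l; apply/orP; right; lia.
have D0 i : (0 < #|D i|)%N.
  rewrite lt0n; apply: contraTneq (Dbig i) => ->.
  by rewrite muln0 -ltnNge (leq_trans _ cT)// !muln_gt0 M0 expn_gt0.
have /fin_all_exists[x xD] i : exists x, x \in D i by apply/card_gt0P.
have Xlt (i j : 'I_M) a b : (i < j)%N -> a \in D i -> b \in D j -> X a < X b.
  by move=> ij /(subsetP (DC i)) + /(subsetP (DC j)); apply: Clt.
have [c [i1 [i2 [i3 [i4 [i5 [[i12 i23 i34 i45] c1 c2 c3]]]]]]] :=
  monochromatic_path (fun i j k => 0 < orientation X Y (x i) (x j) (x k)) Mbig.
have neq (i j : 'I_M) : (i < j)%N -> x i != x j.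
  by move=> /(Xlt i j _ _)/(_ (xD i) (xD j)); apply: contraTneq => ->; rewrite ltxx.
have sgn (i j k : 'I_M) : (i < j)%N -> (j < k)%N ->
    (0 < orientation X Y (x i) (x j) (x k)) = c ->
    0 < (-1) ^+ (~~ c) * orientation X Y (x i) (x j) (x k).
  move=> ij jk; case: c {c1 c2 c3} => /= ori; first by rewrite mul1r.
  rewrite mulN1r oppr_gt0 lt_neqAle leNgt ori andbT.
  by apply: gen.2; apply: neq => //; apply: ltn_trans jk.
(* By homogeneity, one representative per chunk decides the orientation of all transversals. *)
have spread (i j k : 'I_M) : (i < j)%N -> (j < k)%N ->
    0 < (-1) ^+ (~~ c) * orientation X Y (x i) (x j) (x k) ->
    forall a b d, a \in D i -> b \in D j -> d \in D k ->
      0 < (-1) ^+ (~~ c) * orientation X Y a b d.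
  move=> ij jk ori; have [|d dP] := Dst (i, j, k).
    by rewrite mem_filter /= ij jk mem_enum.
  suff -> : ~~ c = d by [].
  have := dP _ _ _ (xD i) (xD j) (xD k); move: ori.
  case: c d {dP c1 c2 c3 sgn} => [] [] //=;
    rewrite !(mulN1r, mul1r) oppr_gt0 => /lt_trans h /h;
    by rewrite ltxx.
have X12 := Xlt _ _ _ _ i12 (xD _) (xD _); have X23 := Xlt _ _ _ _ i23 (xD _) (xD _).
have X34 := Xlt _ _ _ _ i34 (xD _) (xD _); have X45 := Xlt _ _ _ _ i45 (xD _) (xD _).
have o123 := sgn _ _ _ i12 i23 c1; have o234 := sgn _ _ _ i23 i34 c2.
have o345 := sgn _ _ _ i34 i45 c3.
(* The path gives only consecutive triples; the cross pairs at [i3] also need these three. *)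
have o134 := orientation_left X12 X23 X34 o123 o234.
have o235 := orientation_right X23 X34 X45 o234 o345.
have o135 := orientation_right (lt_trans X12 X23) X34 X45 o134 o345.
have i13 := ltn_trans i12 i23; have i35 := ltn_trans i34 i45.
exists (x i3), (~~ c), (D i1), (D i2), (D i4), (D i5); split=> //.
- by move=> a; rewrite inE => /orP[] aD; apply: Xlt aD (xD _).
- by move=> a; rewrite inE => /orP[] aD; apply: Xlt (xD _) aD.
- split=> u v uD vD; (split; first by apply: Xlt uD vD).
    have -> : orientation X Y (x i3) u v = orientation X Y u v (x i3).
      by rewrite /orientation; ring.
    exact: spread o123 _ _ _ uD vD (xD _).
  exact: spread o345 _ _ _ (xD _) uD vD.
move=> u v uD vD; split.
  by apply: (@lt_trans _ _ (X (x i3))); [move: uD|move: vD]; rewrite inE => /orP[] hD;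
    first [exact: Xlt hD (xD _)|exact: Xlt (xD _) hD].
(* Moving [x i3] from the middle to the front is a transposition, so the sign flips for pairs across
   it. *)
have -> : (-1) ^+ (~~ ~~ c) * orientation X Y (x i3) u v =
    (-1) ^+ (~~ c) * orientation X Y u (x i3) v.
  by rewrite /orientation; case: (c) => /=; rewrite ?expr0 ?expr1; ring.
move: uD vD; rewrite !inE => /orP[] uD /orP[] vD.
- exact: spread o134 _ _ _ uD (xD _) vD.
- exact: spread o135 _ _ _ uD (xD _) vD.
- exact: spread o234 _ _ _ uD (xD _) vD.
- exact: spread o235 _ _ _ uD (xD _) vD.
Qed.

(** * A positive-fraction Erdos-Szekeres theorem *)

(** Strip the elements of [D] without predecessor in [D]. A chain in the rest extends downwards by a
    predecessor of its head; a rank on the rest is shifted by one, with rank [0] for the stripped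
    elements. *)
Lemma chain_or_rank (T : finType) (lt : rel T) (k : nat) (D : pred T) :
  (exists s, [/\ size s = k, sorted lt s & all D s]) \/
  (exists h : T -> nat, (forall x, D x -> h x < k)%N /\
     (forall x y, D x -> D y -> lt x y -> h x < h y)%N).
Proof.
elim: k D => [|k IH] D; first by left; exists [::].
pose D' y := D y && [exists x, D x && lt x y].
case: (IH D') => [[s [sk ls Ds]]|[h [hk hlt]]].
  case: s sk ls Ds => [<- _ _|y s sk ls /andP[/andP[Dy /existsP[x /andP[Dx xy]]] Ds]].
    (* An empty chain has no head to extend: any point of [D] serves, and if there is none the rank
       is vacuous. *)
    case: (pickP D) => [x Dx|D0]; first by left; exists [:: x]; rewrite /= Dx.
    by right; exists (fun=> 0%N); split=> x; rewrite D0.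
  left; exists (x :: y :: s); rewrite /= -[size s]/(size (y :: s)).-1 sk xy Dx Dy; split=> //.
    by move: sk => /= [<-].
  by apply: sub_all Ds => z /andP[].
right; exists (fun x => if D' x then (h x).+1 else 0%N); split=> [x Dx|x y Dx Dy xy].
  by case: ifP => // /hk.
have D'y : D' y by rewrite /D' Dy; apply/existsP; exists x; rewrite Dx.
by rewrite D'y; case: ifP => // D'x; rewrite ltnS; apply: hlt.
Qed.

Lemma leq_card_fibers (T U : finType) (h : T -> U) (b : nat) (S : {set T}) :
  (forall u, #|[set x in S | h x == u]| <= b)%N -> (#|S| <= #|U| * b)%N.
Proof.
move=> hb; rewrite -sum1_card (partition_big h predT)//= -sum_nat_const.
apply: leq_sum => u _; rewrite sum1_card; apply: leq_trans (hb u).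
by apply: subset_leq_card; apply/subsetP => x; rewrite !inE.
Qed.

(** The band of [x] is the quotient by [w] of its rank in [S]; within a band the remainder
    determines the point. *)
Lemma quantile_bands (R : realFieldType) (T : finType) (f : T -> R) (S : {set T})
    (w M : nat) :
  {in S &, injective f} -> (#|S| <= w * M.+1)%N ->
  exists c : T -> 'I_M.+1,
    (forall i, #|[set x in S | c x == i]| <= w)%N /\
    {in S &, forall x y, (c x < c y)%N -> f x < f y}.
Proof.
move=> injf Sw; pose r x := #|[set y in S | f y < f x]|.
have rS x : x \in S -> (r x < #|S|)%N.
  move=> xS; apply: proper_card; apply/properP; split.
    by apply/subsetP => y; rewrite inE => /andP[].
  by exists x; rewrite // inE ltxx andbF.
have rlt x y : (r x < r y)%N -> f x < f y.
  rewrite ltNge; apply: contraL => yx; rewrite -leqNgt; apply: subset_leq_card.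
  by apply/subsetP => z; rewrite !inE => /andP[-> zx]; apply: lt_le_trans yx.
have rmono x y : x \in S -> f x < f y -> (r x < r y)%N.
  move=> xS xy; apply: proper_card; apply/properP; split.
    by apply/subsetP => z; rewrite !inE => /andP[-> zx]; apply: lt_trans xy.
  by exists x; rewrite inE ?ltxx ?andbF// xS.
have rinj : {in S &, injective r}.
  move=> x y xS yS e; apply: injf => //.
  by case: (ltgtP (f x) (f y)) => // [/(rmono _ _ xS)|/(rmono _ _ yS)]; rewrite e ltnn.
have rM x : x \in S -> (r x %/ w < M.+1)%N.
  move=> /rS rx; have w0 : (0 < w)%N.
    by move: rx; case: (w) Sw => //; rewrite mul0n leqn0 => /eqP ->.
  by rewrite ltn_divLR// mulnC (leq_trans rx).
exists (fun x => inord (r x %/ w)); split=> [i|x y xS yS].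
  have [w0|w0] := posnP w.
    move: Sw; rewrite w0 mul0n => Sw0.
    by apply: leq_trans Sw0; apply/subset_leq_card/subsetP => x; rewrite inE => /andP[].
  set B := [set x in S | _].
  rewrite -(card_ord w) -(card_in_imset (f := fun x => Ordinal (ltn_pmod (r x) w0)) (D := mem B)).
    exact: max_card.
  move=> x y; rewrite !inE => /andP[xS /eqP xi] /andP[yS /eqP yi] /(congr1 val)/= e.
  apply: rinj => //; rewrite (divn_eq (r x) w) (divn_eq (r y) w) e; congr (_ * _ + _)%N.
  by move: (congr1 val xi) (congr1 val yi); rewrite /= !inordK ?rM// => -> ->.
rewrite !inordK ?rM// => h; apply: rlt; rewrite ltnNge; apply: contraL h => yx.
by rewrite -leqNgt leq_div2r.
Qed.

(* In an (8k^2+1) x (8k^2+1) grid with balanced rows and columns, heavy cells without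
   increasing or decreasing chain of length [k] carry two ranks below [k], and cells
   with equal ranks share a row or a column; so they cover less than half of [S]. *)
Lemma fractional_Erdos_Szekeres (R : realFieldType) (T : finType) (f g : T -> R)
    (S : {set T}) (k : nat) :
  {in S &, injective f} -> {in S &, injective g} ->
  (0 < k)%N -> (8 * k ^ 2 < #|S|)%N ->
  exists (e : bool) (D : 'I_k -> {set T}),
    [/\ forall i, D i \subset S,
        forall i, (#|S| <= 162 * k ^ 4 * #|D i|)%N &
        forall (i j : 'I_k) x y, (i < j)%N -> x \in D i -> y \in D j ->
          f x < f y /\ 0 < (-1) ^+ e * (g y - g x)].
Proof.
move=> injf injg k0; set M := (8 * k ^ 2)%N => MS.
set w := (#|S| %/ M.+1).+1.
have w2 : (w * M.+1 <= 2 * #|S|)%N.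
  have : (0 < #|S| %/ M.+1)%N by rewrite divn_gt0.
  have := leq_divM #|S| M.+1; rewrite /w; nia.
have Sw : (#|S| <= w * M.+1)%N by apply/ltnW/ltn_ceil.
have [c [cw cf]] := quantile_bands injf Sw.
have [d [dw dg]] := quantile_bands injg Sw.
pose cell z := [set x in S | (c x, d x) == z].
pose heavy z := (#|S| <= 2 * M.+1 ^ 2 * #|cell z|)%N.
pose inc := [rel z z' : 'I_M.+1 * 'I_M.+1 | (z.1 < z'.1)%N && (z.2 < z'.2)%N].
pose dec := [rel z z' : 'I_M.+1 * 'I_M.+1 | (z.1 < z'.1)%N && (z'.2 < z.2)%N].
have cellP x z : x \in cell z -> [/\ x \in S, c x = z.1 & d x = z.2].
  by rewrite inE => /andP[xS /eqP <-].
(* Here [M.+1 <= 9 * k ^ 2], and [2 * 9 ^ 2 = 162]. *)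
have Mk : (2 * M.+1 ^ 2 <= 162 * k ^ 4)%N.
  rewrite /M -[(k ^ 4)%N]/(k ^ (2 * 2))%N expnM -!(mulnn (_ ^ 2)) -(mulnn (_.+1)).
  have : (0 < k ^ 2)%N by rewrite expn_gt0 k0.
  by move: (k ^ 2)%N => K; nia.
have concl (e : bool) (lt : rel ('I_M.+1 * 'I_M.+1)) s : transitive lt ->
    (forall z z' x y, lt z z' -> x \in cell z -> y \in cell z' ->
       f x < f y /\ 0 < (-1) ^+ e * (g y - g x)) ->
    [/\ size s = k, sorted lt s & all heavy s] ->
    exists (e : bool) (D : 'I_k -> {set T}),
    [/\ forall i, D i \subset S,
        forall i, (#|S| <= 162 * k ^ 4 * #|D i|)%N &
        forall (i j : 'I_k) x y, (i < j)%N -> x \in D i -> y \in D j ->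
          f x < f y /\ 0 < (-1) ^+ e * (g y - g x)].
  move=> trlt ltP [sk ls Hs]; pose z0 := (ord0 : 'I_M.+1, ord0 : 'I_M.+1).
  exists e, (fun i => cell (nth z0 s i)); split=> [i|i|i j x y ij].
  - by apply/subsetP => x; rewrite inE => /andP[].
  - have : heavy (nth z0 s i) by apply: (allP Hs); rewrite mem_nth// sk.
    by move/leq_trans; apply; rewrite leq_mul2r Mk orbT.
  - by apply: ltP; apply: (sorted_ltn_nth trlt) => //; rewrite inE sk.
case: (chain_or_rank inc k heavy) => [[s]|[a [ak alt]]].
  apply: (concl false) => [y x z /andP[h1 h2] /andP[h3 h4]|z z' x y /andP[/= h1 h2]].
    by rewrite /= (ltn_trans h1 h3) (ltn_trans h2 h4).
  move=> /cellP[xS cx dx] /cellP[yS cy dy]; rewrite mul1r subr_gt0.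
  by rewrite cf ?dg// ?cx ?cy ?dx ?dy.
case: (chain_or_rank dec k heavy) => [[s]|[b [bk blt]]].
  apply: (concl true) => [y x z /andP[h1 h2] /andP[h3 h4]|z z' x y /andP[/= h1 h2]].
    by rewrite /= (ltn_trans h1 h3) (ltn_trans h4 h2).
  move=> /cellP[xS cx dx] /cellP[yS cy dy]; rewrite mulN1r opprB subr_gt0.
  by rewrite cf ?dg// ?cx ?cy ?dx ?dy.
exfalso.
pose H := [set x in S | heavy (c x, d x)].
(* Each of the [M.+1 ^ 2] cells, if light, holds less than a fraction [1 / (2 * M.+1 ^ 2)] of
   [S]. *)
have light : (2 * #|S :\: H| <= #|S|)%N.
  have b0 : (0 < 2 * M.+1 ^ 2)%N by rewrite muln_gt0 expn_gt0.
  have : (#|S :\: H| <= #|{: 'I_M.+1 * 'I_M.+1}| * (#|S| %/ (2 * M.+1 ^ 2)))%N.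
    apply: (leq_card_fibers (h := fun x => (c x, d x))) => z.
    rewrite leq_divRL// mulnC; case: (boolP (heavy z)) => [hz|].
      rewrite (_ : [set _ in _ | _] = set0) ?cards0 ?muln0//.
      apply/setP => x; rewrite !inE; case: eqP => [->|]; last by rewrite andbF.
      by rewrite hz; case: (x \in S).
    rewrite -ltnNge => /ltnW; apply: leq_trans; rewrite leq_mul2l; apply/orP; right.
    apply: subset_leq_card; apply/subsetP => x; rewrite !inE => /andP[/andP[_ ->]].
    by [].
  rewrite card_prod card_ord; have := leq_divM #|S| (2 * M.+1 ^ 2).
  by move: (_ %/ _)%N => v; rewrite -mulnn; nia.
have : (#|H| <= #|{: 'I_k * 'I_k}| * (2 * w))%N.
  have HE x : (x \in H) = (x \in S) && heavy (c x, d x) by rewrite /H inE.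
  (* The reduction modulo [k] only types the ranks in ['I_k]; on heavy cells it changes nothing. *)
  pose lab x := (Ordinal (ltn_pmod (a (c x, d x)) k0), Ordinal (ltn_pmod (b (c x, d x)) k0)).
  apply: (leq_card_fibers (h := lab)) => l.
  have [->|[x]] := set_0Vmem [set x in H | lab x == l]; first by rewrite cards0.
  rewrite inE HE => /andP[/andP[xS hx] /eqP <-] {l}.
  apply: leq_trans (_ : #|[set y in S | c y == c x] :|:
                          [set y in S | d y == d x]| <= _)%N; last first.
    by rewrite (leq_trans (leq_card_setU _ _))// mul2n -addnn leq_add.
  apply: subset_leq_card; apply/subsetP => y.
  rewrite inE HE => /andP[/andP[yS hy] /eqP[]]; rewrite !inE yS /=.
  rewrite !modn_small ?ak ?bk// => ea eb.
  apply/orP; case: (ltngtP (c x) (c y)) => cxy; last by left; apply/eqP/val_inj.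
    case: (ltngtP (d x) (d y)) => dxy; last by right; apply/eqP/val_inj.
      by have := alt _ _ hx hy; rewrite /= cxy dxy => /(_ isT); rewrite ea ltnn.
    by have := blt _ _ hx hy; rewrite /= cxy dxy => /(_ isT); rewrite eb ltnn.
  case: (ltngtP (d x) (d y)) => dxy; last by right; apply/eqP/val_inj.
    by have := blt _ _ hy hx; rewrite /= cxy dxy => /(_ isT); rewrite eb ltnn.
  by have := alt _ _ hy hx; rewrite /= cxy dxy => /(_ isT); rewrite ea ltnn.
rewrite card_prod card_ord.
have := cardsID H S; rewrite (setIidPr _); last first.
  by apply/subsetP => x; rewrite inE => /andP[].
move=> e h.
(* With [m = #|S| %/ M.+1 >= 1], [w = m + 1 <= 2 * m], so
   [#|S| <= 8 * k ^ 2 * m < M.+1 * m <= #|S|], which is absurd. *)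
have h2 : (#|S| <= 4 * k ^ 2 * w)%N by rewrite -mulnn; lia.
have h3 : (8 * k ^ 2 * (#|S| %/ M.+1) < #|S|)%N.
  apply: leq_trans (leq_divM #|S| M.+1); rewrite mulnC ltn_mul2l /M.
  by rewrite divn_gt0// MS ltnSn.
have : (0 < #|S| %/ M.+1)%N by rewrite divn_gt0.
by move: h2 h3; rewrite /w; nia.
Qed.

(** * Blocks with prescribed orientations at a point *)

(** On one side of [q], the orientation of [q, u, v] has the sign of the increase of the slope to
    [q], so monotone blocks for abscissa and slope are what is sought. Equal slopes would make
    [q, u, v] collinear. *)
Lemma oriented_blocks (R : realFieldType) (T : finType) (X Y : T -> R) (q : T)
    (U : {set T}) (k : nat) :
  generic X Y ->
  {in U, forall u, X u < X q} \/ {in U, forall u, X q < X u} ->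
  (0 < k)%N -> (8 * k ^ 2 < #|U|)%N ->
  exists e (D : 'I_k -> {set T}),
    [/\ forall i, D i \subset U,
        forall i, (#|U| <= 162 * k ^ 4 * #|D i|)%N &
        forall i j : 'I_k, (i < j)%N -> precedes X Y q e (D i) (D j)].
Proof.
move=> gen side k0 kU; pose g x := slope X Y q x.
have sideM u v : u \in U -> v \in U -> 0 < (X u - X q) * (X v - X q).
  by case: side => s /s hu /s hv; [rewrite nmulr_rgt0|apply: mulr_gt0]; lra.
have oriE u v : u \in U -> v \in U ->
    orientation X Y q u v = (X u - X q) * (X v - X q) * (g v - g u).
  move=> uU vU; have uq : X u - X q != 0.
    by apply: contraTneq (sideM u u uU uU) => ->; rewrite mul0r ltxx.
  have vq : X v - X q != 0.
    by apply: contraTneq (sideM v v vU vU) => ->; rewrite mul0r ltxx.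
  by rewrite /orientation /g /slope; field; rewrite uq vq.
have injg : {in U &, injective g}.
  move=> u v uU vU guv; apply/eqP/negPn/negP => uv.
  have qU w : w \in U -> q != w.
    by move=> wU; apply: contraTneq (sideM w w wU wU) => ->; rewrite subrr mul0r ltxx.
  by have /eqP[] := gen.2 q u v (qU _ uU) (qU _ vU) uv; rewrite oriE// guv subrr mulr0.
have [e [D [DU Dsz Dlt]]] :=
  fractional_Erdos_Szekeres (in2W gen.1) injg k0 kU.
exists e, D; split=> // i j ij u v uD vD.
have [lt pos] := Dlt i j u v ij uD vD; split=> //.
have uU := subsetP (DU i) u uD; have vU := subsetP (DU j) v vD.
by rewrite oriE// mulrCA mulr_gt0// sideM.
Qed.

Lemma precedesS (R : numDomainType) (T : finType) (X Y : T -> R) (q : T) (e : bool)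
    (U V U' V' : {set T}) :
  U' \subset U -> V' \subset V -> precedes X Y q e U V -> precedes X Y q e U' V'.
Proof. by move=> /subsetP sU /subsetP sV UV u v /sU uU /sV; apply: UV. Qed.

Lemma opposite_blocks (R : realFieldType) :
  exists2 c : nat, (0 < c)%N & forall (k : nat) (T : finType) (X Y : T -> R),
  (0 < k)%N -> generic X Y -> (c * (8 * k ^ 2).+1 <= #|T|)%N ->
  exists q e (A B : 'I_k -> {set T}),
    [/\ forall i, (#|T| <= c * k ^ 4 * #|A i|)%N /\ (#|T| <= c * k ^ 4 * #|B i|)%N,
        forall i j, precedes X Y q e (A i) (B j),
        forall i j : 'I_k, (i < j)%N -> precedes X Y q (~~ e) (A i) (A j) &
        forall i j : 'I_k, (i < j)%N -> precedes X Y q (~~ e) (B i) (B j)].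
Proof.
have [c c0 conf] := convex_configuration R.
exists (c * 162)%N => [|k T X Y k0 gen big]; first by rewrite muln_gt0 c0.
have [|q [e [A [A' [B [B' [[sA sA' sB sB'] Aq Bq [AA' BB'] AB]]]]]]] := conf T X Y gen.
  by apply: leq_trans big; rewrite -mulnA leq_pmulr.
(* The threshold on [#|T|] is set so that every chunk still exceeds [8 * k ^ 2]. *)
have bigU (U : {set T}) : (#|T| <= c * #|U|)%N -> (8 * k ^ 2 < #|U|)%N.
  move=> sU; rewrite -(leq_pmul2l c0); apply: leq_trans sU; apply: leq_trans big.
  by rewrite -mulnA leq_mul2l leq_pmull// orbT.
have blocks (U : {set T}) : (#|T| <= c * #|U|)%N ->
    {in U, forall u, X u < X q} \/ {in U, forall u, X q < X u} ->
    exists d (D : 'I_k -> {set T}),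
    [/\ forall i, D i \subset U,
        forall i, (#|T| <= c * 162 * k ^ 4 * #|D i|)%N &
        forall i j : 'I_k, (i < j)%N -> precedes X Y q d (D i) (D j)].
  move=> sU side; have [d [D [DU Dsz Dlt]]] := oriented_blocks gen side k0 (bigU _ sU).
  exists d, D; split=> // i; apply: leq_trans sU _.
  by rewrite -!(mulnA c) leq_mul2l Dsz orbT.
have [|d [D [DA Dsz Dlt]]] := blocks A sA.
  by left=> a aA; apply: Aq; rewrite inE aA.
have [|d' [D' [DA' Dsz' Dlt']]] := blocks A' sA'.
  by left=> a aA; apply: Aq; rewrite inE aA orbT.
have [|f [F [FB Fsz Flt]]] := blocks B sB.
  by right=> a aA; apply: Bq; rewrite inE aA.
have [|f' [F' [FB' Fsz' Flt']]] := blocks B' sB'.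
  by right=> a aA; apply: Bq; rewrite inE aA orbT.
have [/andP[/eqP de /eqP d'e]|dd] := boolP ((d == ~~ e) && (d' == ~~ e)).
  exists q, e, D, D'; rewrite -{1}de -d'e; split=> // i j.
  exact: precedesS AA'.
have [/andP[/eqP fe /eqP f'e]|ff] := boolP ((f == ~~ e) && (f' == ~~ e)).
  exists q, e, F, F'; rewrite -{1}fe -f'e; split=> // i j.
  exact: precedesS BB'.
have [G [GA Gsz Glt]] : exists G : 'I_k -> {set T},
    [/\ forall i, G i \subset A :|: A',
        forall i, (#|T| <= c * 162 * k ^ 4 * #|G i|)%N &
        forall i j : 'I_k, (i < j)%N -> precedes X Y q e (G i) (G j)].
  have [de|de] := eqVneq d e.
    by exists D; rewrite -{1}de; split=> // i; rewrite subsetU// DA.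
  have d'e : d' = e by move: de dd; case: (d) (d') (e) => [] [] [].
  by exists D'; rewrite -{1}d'e; split=> // i; rewrite subsetU// DA' orbT.
have [H [HB Hsz Hlt]] : exists H : 'I_k -> {set T},
    [/\ forall i, H i \subset B :|: B',
        forall i, (#|T| <= c * 162 * k ^ 4 * #|H i|)%N &
        forall i j : 'I_k, (i < j)%N -> precedes X Y q e (H i) (H j)].
  have [fe|fe] := eqVneq f e.
    by exists F; rewrite -{1}fe; split=> // i; rewrite subsetU// FB.
  have f'e : f' = e by move: fe ff; case: (f) (f') (e) => [] [] [].
  by exists F'; rewrite -{1}f'e; split=> // i; rewrite subsetU// FB' orbT.
(* Inner pairs now have orientation [e] and cross pairs [~~ e], so the returned sign is flipped. *)
exists q, (~~ e), G, H; rewrite negbK; split=> // i j.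
exact: precedesS AB.
Qed.

(** * Shears, convex hulls and lines in the plane *)

(** A pair with distinct [g]-values collides for the single parameter [s]; one plus the sum of all
    [|s|] exceeds every such value. *)
Lemma exists_injective_shear (R : realFieldType) (T : finType) (f g : T -> R) :
  injective (fun x => (f x, g x)) ->
  exists t, injective (fun x => f x + t * g x).
Proof.
move=> inj; pose s (z : T * T) := (f z.1 - f z.2) / (g z.2 - g z.1).
exists (1 + \sum_z `|s z|) => x y; set t := 1 + _ => e.
have ts : s (x, y) < t.
  rewrite /t (bigD1 (x, y))//=; apply: le_lt_trans (ler_norm _) _.
  by rewrite addrCA ltrDl ltr_wpDr// sumr_ge0.
have [gxy|gxy] := eqVneq (g x) (g y).
  by apply: inj; move: e; rewrite gxy => /addIr ->.
move: ts; suff -> : t = s (x, y) by rewrite ltxx.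
have gyx : g y - g x != 0 by rewrite subr_eq0 eq_sym.
apply: (mulIf gyx); rewrite /s /= divfK//.
by rewrite mulrBr; move: e; move: t => t; lra.
Qed.

Import classical_sets.
Local Open Scope classical_set_scope.

Lemma convex_hull_affine_gt0 (R : realType) (f : 'rV[R]_2 -> R) (A : set 'rV[R]_2) :
  (forall x y s, f (s *: x + (1 - s) *: y) = s * f x + (1 - s) * f y) ->
  (forall x, A x -> 0 < f x) -> forall x, convex_hull A x -> 0 < f x.
Proof.
move=> faff fA x; apply: (@smallest_sub _ _ _ [set x | 0 < f x]) => //.
move=> u v s; rewrite !inE /= => fu fv.
by rewrite [X in f X](_ : _ = s%:inum *: u + (1 - s%:inum) *: v)// faff convR_gt0.
Qed.

Definition abscissa (R : realType) (t : R) (p : 'rV[R]_2) : R := p 0 0 + t * p 0 1.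
Definition ordinate (R : realType) (p : 'rV[R]_2) : R := p 0 1.

Lemma row2P (R : realType) (p q : 'rV[R]_2) : p 0 0 = q 0 0 -> p 0 1 = q 0 1 -> p = q.
Proof.
move=> e0 e1; apply/rowP => -[[|[|//]] i].
  by rewrite (_ : Ordinal i = 0)//; apply/val_inj.
by rewrite (_ : Ordinal i = 1)//; apply/val_inj.
Qed.

(** On the line, [X z - X x] and the orientation of [q, x, z] are both proportional to the
    parameter, so their product is a square times a quantity of sign opposite to [(-1) ^+ e]. On the
    hull both are affine of fixed sign, with product of sign [(-1) ^+ e]. The bit [d] tells whether
    [B] lies to the left of [x]. *)
Lemma line_misses_hull (R : realType) (t : R) (q : 'rV[R]_2) (e d : bool)
    (x y : 'rV[R]_2) (B : set 'rV[R]_2) :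
  let X := abscissa t in let Y := @ordinate R in
  0 < (-1) ^+ (~~ e) * ((X y - X x) * orientation X Y q x y) ->
  (forall b, B b -> 0 < (-1) ^+ d * (X b - X x)) ->
  (forall b, B b -> 0 < (-1) ^+ d * (-1) ^+ e * orientation X Y q x b) ->
  line x y `&` convex_hull B = set0.
Proof.
move=> X Y xy BX BY; apply/seteqP; split=> // _ [[s _ <-] zB].
set z := x + s *: (y - x) in zB.
have affX u v r : X (r *: u + (1 - r) *: v) = r * X u + (1 - r) * X v.
  by rewrite /X /abscissa !mxE; ring.
have affY u v r : Y (r *: u + (1 - r) *: v) = r * Y u + (1 - r) * Y v.
  by rewrite /Y /ordinate !mxE.
have h1 : 0 < (-1) ^+ d * (X z - X x).
  apply: (convex_hull_affine_gt0 (f := fun z => (-1) ^+ d * (X z - X x)) _ BX zB).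
  by move=> u v r; rewrite affX; ring.
have h2 : 0 < (-1) ^+ d * (-1) ^+ e * orientation X Y q x z.
  apply: (convex_hull_affine_gt0
    (f := fun z => (-1) ^+ d * (-1) ^+ e * orientation X Y q x z) _ BY zB).
  by move=> u v r; rewrite /orientation affX affY; ring.
have zE : z = s *: y + (1 - s) *: x.
  by rewrite /z scalerBr scalerBl scale1r addrCA addrC -addrA [- _ + _]addrC.
have e1 : X z - X x = s * (X y - X x) by rewrite zE affX; ring.
have e2 : orientation X Y q x z = s * orientation X Y q x y.
  by rewrite zE /orientation affX affY; ring.
move: h1 h2 xy; rewrite e1 e2 signrN; move: (orientation _ _ _ _ _) (X y - X x) => D2 D1 h1 h2.
have : 0 < (-1) ^+ d * (s * D1) * ((-1) ^+ d * (-1) ^+ e * (s * D2)) by apply: mulr_gt0.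
have -> : (-1) ^+ d * (s * D1) * ((-1) ^+ d * (-1) ^+ e * (s * D2)) =
    ((-1) ^+ d * s) ^+ 2 * ((-1) ^+ e * (D1 * D2)) by ring.
rewrite mulNr oppr_gt0 => h3 h4.
by have := mulr_ge0_le0 (sqr_ge0 ((-1) ^+ d * s)) (ltW h4); rewrite leNgt h3.
Qed.

Lemma general_position_generic (R : realType) (P : {fset 'rV[R]_2}) (t : R) :
  general_position P -> injective (fun p : P => abscissa t (val p)) ->
  generic (fun p : P => abscissa t (val p)) (fun p : P => ordinate (val p)).
Proof.
move=> gp inj; split=> // a b c ab ac bc; apply/eqP => ori0.
apply: (gp (val a) (val b) (val c)); rewrite ?(inj_eq val_inj)//; try exact: valP.
have nX : abscissa t (val b) - abscissa t (val a) != 0.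
  by rewrite subr_eq0 (inj_eq inj) eq_sym.
exists (val a), (val b); split; first by rewrite (inj_eq val_inj).
- by exists 0 => //; rewrite scale0r addr0.
- by exists 1 => //; rewrite scale1r addrC subrK.
(* As [a] and [b] have distinct abscissas, the ratio of abscissa differences is the parameter of [c]
   on the line [a b]. *)
exists ((abscissa t (val c) - abscissa t (val a)) /
        (abscissa t (val b) - abscissa t (val a))) => //.
have e1 : (val c) 0 1 = (val a) 0 1 +
    (abscissa t (val c) - abscissa t (val a)) / (abscissa t (val b) - abscissa t (val a)) *
    ((val b) 0 1 - (val a) 0 1).
  have : ((val c) 0 1 - (val a) 0 1) * (abscissa t (val b) - abscissa t (val a)) =
      (abscissa t (val c) - abscissa t (val a)) * ((val b) 0 1 - (val a) 0 1).
    by apply/eqP; rewrite -subr_eq0 mulrC; apply/eqP.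
  by rewrite mulrAC => /(canRL (mulfK nX)) <-; rewrite addrC subrK.
apply: row2P; rewrite !mxE; last by rewrite -e1.
set s := _ / _ in e1 *.
have e2 : abscissa t (val c) = abscissa t (val a) + s * (abscissa t (val b) - abscissa t (val a)).
  by rewrite /s divfK// addrC subrK.
by move: e2 e1; rewrite /abscissa; move: s => s e2 e1; nra.
Qed.

(** * Assembly: from blocks to mutually avoiding transversals *)

Theorem theorem1p4 (R : realType) :
  exists eps : nat -> R,
    (forall k : nat, (0 < k)%N ->
       0 < eps k /\
       exists N : nat, forall P : {fset 'rV[R]_2},
         (N <= #|` P|)%N -> general_position P ->
         exists A B : 'I_k -> {fset 'rV[R]_2},
           [/\ forall i, (A i `<=` P)%fset /\ (B i `<=` P)%fset,
               [/\ forall i j, i != j -> [disjoint A i & A j]%fset,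
                   forall i j, i != j -> [disjoint B i & B j]%fset &
                   forall i j, [disjoint A i & B j]%fset],
               forall i, eps k * #|` P|%:R <= #|` A i|%:R /\
                         eps k * #|` P|%:R <= #|` B i|%:R &
               forall a b : 'I_k -> 'rV[R]_2,
                 (forall i, a i \in A i) -> (forall i, b i \in B i) ->
                 mutually_avoiding (range a) (range b)]) /\
    (exists c : R, 0 < c /\ forall k : nat, (0 < k)%N -> c / k%:R ^+ 4 <= eps k).
Proof.
have [c c0 blocks] := opposite_blocks R.
exists (fun k => c%:R^-1 / k%:R ^+ 4); split; last first.
  by exists c%:R^-1; split=> //; rewrite invr_gt0 ltr0n.
move=> k k0; have k4 : 0 < k%:R ^+ 4 :> R by rewrite exprn_gt0 ?ltr0n.
have cR : 0 < c%:R :> R by rewrite ltr0n.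
split; first by rewrite divr_gt0 ?invr_gt0.
exists (c * (8 * k ^ 2).+1)%N => P; rewrite cardfE => bigP gp.
have [|t inj] := @exists_injective_shear R P (fun p => val p 0 0) (fun p => val p 0 1).
  by move=> p p' [e0 e1]; apply: val_inj; apply: row2P.
have gen := general_position_generic gp inj.
have [q [e [A [B [sz AB AA BB]]]]] := blocks k P _ _ k0 gen bigP.
pose F (D : {set P}) := [fset val x | x in D]%fset.
have FP (D : {set P}) p : reflect (exists2 x : P, x \in D & p = val x) (p \in F D).
  by apply: (iffP (imfsetP _ _ _ _)).
have Fsz (D : {set P}) : (#|(P : finType)| <= c * k ^ 4 * #|D|)%N ->
    c%:R^-1 / k%:R ^+ 4 * #|(P : finType)|%:R <= #|` F D|%:R :> R.
  have -> : #|` F D| = #|D|.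
    rewrite card_imfset/=; last exact: val_inj.
    by rewrite cardE; congr size.
  rewrite -(ler_nat R) natrM (natrM _ c) natrX => h.
  have ck : 0 < c%:R * k%:R ^+ 4 :> R by apply: mulr_gt0.
  by rewrite -invfM mulrC ler_pdivrMr; [rewrite mulrC|].
have lt_disj (D D' : {set P}) d : precedes (fun p : P => abscissa t (val p))
    (fun p : P => ordinate (val p)) q d D D' -> [disjoint F D & F D']%fset.
  move=> h; apply/fdisjointP => p /FP[x xD ->]; apply/negP => /FP[y yD /val_inj exy].
  by have [] := h x y xD yD; rewrite exy ltxx.
have disj (D : 'I_k -> {set P}) d : (forall i j : 'I_k, (i < j)%N ->
    precedes (fun p : P => abscissa t (val p)) (fun p : P => ordinate (val p)) q d (D i) (D j)) ->
    forall i j, i != j -> [disjoint F (D i) & F (D j)]%fset.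
  move=> h i j; case: (ltngtP i j) => [ij _|ji _|/val_inj ->]; last by rewrite eqxx.
    exact: lt_disj (h _ _ ij).
  by rewrite fdisjoint_sym; apply: lt_disj (h _ _ ji).
have sub (D : {set P}) : (F D `<=` P)%fset.
  by apply/fsubsetP => p /FP[x _ ->]; apply: valP.
exists (fun i => F (A i)), (fun i => F (B i)); split=> [i|||a b aA bB].
- by split; apply: sub.
- split; [exact: disj AA|exact: disj BB|].
  by move=> i j; apply: lt_disj (AB i j).
- by move=> i; have [sA sB] := sz i; split; apply: Fsz.
(* The blocks are compared for [i < j] only, but the product of abscissa difference and orientation
   is symmetric in the two points. *)
have pairs (D : 'I_k -> {set P}) (f : 'I_k -> 'rV[R]_2) :
    (forall i j : 'I_k, (i < j)%N -> precedes (fun p : P => abscissa t (val p))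
      (fun p : P => ordinate (val p)) q (~~ e) (D i) (D j)) ->
    (forall i, f i \in F (D i)) -> forall i j, f i != f j ->
    0 < (-1) ^+ (~~ e) * ((abscissa t (f j) - abscissa t (f i)) *
       orientation (abscissa t) (@ordinate R) (val q) (f i) (f j)).
  move=> Dlt fD.
  have lt (i j : 'I_k) : (i < j)%N -> 0 < (-1) ^+ (~~ e) * ((abscissa t (f j) - abscissa t (f i)) *
       orientation (abscissa t) (@ordinate R) (val q) (f i) (f j)).
    have /FP[x xD ->] := fD i; have /FP[y yD ->] := fD j => ij.
    have [h1 h2] := Dlt i j ij x y xD yD.
    by rewrite mulrCA mulr_gt0// subr_gt0.
  move=> i j; case: (ltngtP i j) => [/lt //|/lt + _|/val_inj ->]; last by rewrite eqxx.
  by congr (_ < _); rewrite /orientation; ring.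
have cross i j : abscissa t (a i) < abscissa t (b j) /\
    0 < (-1) ^+ e * orientation (abscissa t) (@ordinate R) (val q) (a i) (b j).
  have /FP[x xD ->] := aA i; have /FP[y yD ->] := bB j; exact: (AB i j x y xD yD).
split=> _ _ [i _ <-] [j _ <-] ij.
- apply: (line_misses_hull (d := false) (pairs _ _ AA aA _ _ ij)) => _ [l _ <-].
    by rewrite mul1r subr_gt0; case: (cross i l).
  by rewrite mul1r; case: (cross i l).
(* Seen from [B], the other set lies to the left, and swapping the two points negates the
   orientation. *)
- apply: (line_misses_hull (d := true) (pairs _ _ BB bB _ _ ij)) => _ [l _ <-].
    by rewrite mulN1r opprB subr_gt0; case: (cross l i).
  have [_] := cross l i; congr (_ < _); rewrite /orientation expr1; ring.
Qed.
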